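(* Let $d\ge 2n$ (with $d=d(n)$). (1) Any privacy mechanism which, for every database $D=(U|\mathbf s)$ with $U\in\mathbb R^{n\times d}$ and $\mathbf s\in\{0,1\}^n$, releases the estimators $\hat\theta_1,\dots,\hat\theta_d$ of the linear regression model (respectively, of the logistic regression model) between each column of $U$ and $\mathbf s$ by adding $o(1/\sqrt n)$ noise to each estimator (i.e. outputs $\tilde\theta_i$ with $|\tilde\theta_i-\hat\theta_i|=o(1/\sqrt n)$ for all $i$) is attribute non-private; the attack achieving this runs in time $O(dn^2)$. (2) There exists a constant $\gamma>0$ such that any mechanism which, for every such database, releases $\tilde\theta_1,\dots,\tilde\theta_d$ with $|\tilde\theta_i-\hat\theta_i|=o(1/\sqrt n)$ for at least a $1-\gamma$ fraction of the indices $i$ (arbitrary noise on the rest), for the linear (respectively logistic) regression estimators, is attribute non-private; the attack achieving this runs in time $O(d^2n^3+d^{2.5}n^2)$.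
   Context: For a column $\mathbf u=(u_1,\dots,u_n)^\top$ of $U$ (one regressor, no intercept), the linear regression estimator is the maximum-likelihood/least-squares estimator $\hat\theta=\arg\min_{\theta\in\mathbb R}\sum_j(s_j-u_j\theta)^2$, i.e. the solution of $\mathbf u^\top\mathbf s-\mathbf u^\top\mathbf u\,\theta=0$; the logistic regression estimator is the maximizer of the log-likelihood $\sum_j\big(s_ju_j\theta-\ln(1+e^{u_j\theta})\big)$, i.e. the solution of $\mathbf u^\top\mathbf s-\mathbf u^\top\zeta(\theta)=0$ with $\zeta_j(\theta)=e^{u_j\theta}/(1+e^{u_j\theta})$. A randomized mechanism $\mathcal M$ allows $(\alpha,\beta)$ attribute reconstruction if there exist a setting $U$ of the public attributes and an algorithm $\mathcal A$ such that for every $\mathbf s\in\{0,1\}^n$, $\Pr_{\mathbf y\leftarrow\mathcal M((U|\mathbf s))}[d_H(\mathbf s,\mathcal A(U,\mathbf y))\le\alpha]\ge1-\beta$ ($d_H$ = Hamming distance). A family of mechanisms (indexed by $n$, $d=d(n)$) is attribute non-private if for an infinite sequence of $n$ it allows $(\alpha,\beta)$ reconstruction with $\alpha=o(n)$, $\beta=o(1)$. *)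

(* Defs.v *)
From HB Require Import structures.
From mathcomp Require Import all_boot all_order all_algebra.
From mathcomp Require Import all_classical all_reals all_analysis.

Set Implicit Arguments.
Unset Strict Implicit.
Unset Printing Implicit Defensive.

Import Order.TTheory GRing.Theory Num.Theory.
Import numFieldNormedType.Exports.

Local Open Scope classical_set_scope.
Local Open Scope ring_scope.

Definition bits (n : nat) := {ffun 'I_n -> bool}.

Definition hamming (n : nat) (s s' : bits n) : nat :=
  #|[set j | s j != s' j]%SET|.

(** * Regression of the secret bit on one public attribute, no intercept *)

Variant regression := Linear | Logistic.

Definition squared_error (R : realType) (n : nat) (u : 'cV[R]_n) (s : bits n)
    (theta : R) : R :=
  \sum_(j < n) ((s j)%:R - u j ord0 * theta) ^+ 2.

Definition log_likelihood (R : realType) (n : nat) (u : 'cV[R]_n) (s : bits n)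
    (theta : R) : R :=
  \sum_(j < n) ((s j)%:R * u j ord0 * theta - ln (1 + expR (u j ord0 * theta))).

(** The estimator is the unique optimizer. For some data there is none: the
    optimizer is not unique if [u = 0], and the logistic log-likelihood is not
    attained if the sign of [u] separates the two values of [s]. *)
Definition is_estimator (R : realType) (m : regression) (n : nat)
    (u : 'cV[R]_n) (s : bits n) (theta : R) : Prop :=
  match m with
  | Linear => forall theta' : R, theta' != theta ->
      squared_error u s theta < squared_error u s theta'
  | Logistic => forall theta' : R, theta' != theta ->
      log_likelihood u s theta' < log_likelihood u s theta
  end.

(** * Mechanisms *)

(** The output law, on R^d with its Borel sigma-algebra, for each database. *)
Definition mechanism (R : realType) (n d : nat) :=
  'M[R]_(n, d) -> bits n -> probability (d.-tuple (measurableTypeR R)) R.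

Definition mechanism_family (R : realType) (d : nat -> nat) :=
  forall n : nat, mechanism R n (d n).

(** Nothing is required at a column that has no estimator (see
    [is_estimator]); demanding that one exist would leave no mechanism at all. *)
Definition accurate_at (R : realType) (m : regression) (n d : nat)
    (U : 'M[R]_(n, d)) (s : bits n) (delta : R) (y : d.-tuple R) (i : 'I_d)
    : Prop :=
  forall theta : R, is_estimator m (col i U) s theta ->
    `|tnth y i - theta| <= delta.

Definition little_o_inv_sqrt (R : realType) (delta : nat -> R) : Prop :=
  delta n * Num.sqrt n%:R @[n --> \oo] --> (0 : R).

Definition releases_all_estimators (R : realType) (m : regression)
    (d : nat -> nat) (M : mechanism_family R d) : Prop :=
  exists2 delta : nat -> R, little_o_inv_sqrt delta &
    forall (n : nat) (U : 'M[R]_(n, d n)) (s : bits n),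
      {ae M n U s, forall y, forall i, accurate_at m U s (delta n) y i}.

Definition releases_most_estimators (R : realType) (m : regression)
    (gamma : R) (d : nat -> nat) (M : mechanism_family R d) : Prop :=
  exists2 delta : nat -> R, little_o_inv_sqrt delta &
    forall (n : nat) (U : 'M[R]_(n, d n)) (s : bits n),
      {ae M n U s, forall y, (1 - gamma) * (d n)%:R <=
        #|[set i | `[< accurate_at m U s (delta n) y i >]]%SET|%:R}.

(** * Attacks and attribute non-privacy *)

Definition attack (R : realType) :=
  forall n d : nat, 'M[R]_(n, d) -> d.-tuple R -> bits n.

(** The probability is an inner one, so that it makes sense for attacks that
    are not measurable; for a measurable attack take for [E] the whole event. *)
Definition allows_reconstruction_by (R : realType) (n d : nat)
    (M : mechanism R n d) (A : 'M[R]_(n, d) -> d.-tuple R -> bits n)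
    (alpha beta : R) : Prop :=
  exists U : 'M[R]_(n, d), forall s : bits n,
    exists E : set (d.-tuple (measurableTypeR R)),
      [/\ measurable E,
          E `<=` [set y | (hamming s (A U y))%:R <= alpha] &
          ((1 - beta)%:E <= M U s E)%E].

(** [M] is attribute non-private iff this holds for some [A]; the attack is
    kept as a parameter so that its running time can be bounded. *)
Definition attribute_non_private_by (R : realType) (A : attack R)
    (d : nat -> nat) (M : mechanism_family R d) : Prop :=
  exists (nu : nat -> nat) (alpha beta : nat -> R),
    [/\ {homo nu : k l / (k < l)%N},
        alpha k / (nu k)%:R @[k --> \oo] --> (0 : R),
        beta k @[k --> \oo] --> (0 : R) &
        forall k, allows_reconstruction_by (M (nu k)) (@A (nu k) (d (nu k)))
                    (alpha k) (beta k)].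

(** * Running time: real RAM

    Structured programs over an integer memory, a real memory (both with
    indirect addressing), the read-only inputs [U] and [y], and an output bit
    array; [n] and [d] are initially in I[0] and I[1]. Each instruction and
    each evaluation of a test costs one time unit. Reals are exact; [exp] is a
    primitive, and there is no rounding or other passage from reals to integers
    except through comparisons. *)

Inductive instr :=
| IConst (x c : nat)
| IAdd (x y z : nat)
| ISub (x y z : nat)            (* truncated *)
| ILoad (x p : nat)             (* I[x] := I[I[p]] *)
| IStore (p x : nat)            (* I[I[p]] := I[x] *)
| RConst (x : nat) (c : int)
| RAdd (x y z : nat)
| RSub (x y z : nat)
| RMul (x y z : nat)
| RDiv (x y z : nat)            (* division by 0 gives 0 *)
| RExp (x y : nat)
| RLoad (x p : nat)             (* R[x] := R[I[p]] *)
| RStore (p x : nat)            (* R[I[p]] := R[x] *)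
| ReadAttr (x p q : nat)        (* R[x] := U[I[p], I[q]] *)
| ReadResp (x p : nat)          (* R[x] := y[I[p]] *)
| Write (p : nat) (b : bool).   (* out[I[p]] := b *)

Inductive test :=
| ILe (x y : nat)
| RLe (x y : nat).

Inductive prog :=
| Skip
| Do (c : instr)
| Seq (p q : prog)
| If (b : test) (p q : prog)
| While (b : test) (p : prog).

Record state (R : realType) := State {
  imem : nat -> nat;
  rmem : nat -> R;
  omem : nat -> bool }.

Definition upd (T : Type) (f : nat -> T) (x : nat) (v : T) : nat -> T :=
  fun y => if y == x then v else f y.

Section Semantics.
Variables (R : realType) (n d : nat) (U : 'M[R]_(n, d)) (y : d.-tuple R).

(** Out-of-range reads give 0. *)
Definition read_attr (j i : nat) : R :=
  if insub j is Some j' then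
    if insub i is Some i' then U j' i' else 0
  else 0.

Definition read_resp (i : nat) : R :=
  if insub i is Some i' then tnth y i' else 0.

Definition step (c : instr) (st : state R) : state R :=
  let I := imem st in
  let r := rmem st in
  let o := omem st in
  let setI x v := State (upd I x v) r o in
  let setR x v := State I (upd r x v) o in
  match c with
  | IConst x c => setI x c
  | IAdd x y z => setI x (I y + I z)%N
  | ISub x y z => setI x (I y - I z)%N
  | ILoad x p => setI x (I (I p))
  | IStore p x => setI (I p) (I x)
  | RConst x c => setR x c%:~R
  | RAdd x y z => setR x (r y + r z)
  | RSub x y z => setR x (r y - r z)
  | RMul x y z => setR x (r y * r z)
  | RDiv x y z => setR x (r y / r z)
  | RExp x y => setR x (expR (r y))
  | RLoad x p => setR x (r (I p))
  | RStore p x => setR (I p) (r x)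
  | ReadAttr x p q => setR x (read_attr (I p) (I q))
  | ReadResp x p => setR x (read_resp (I p))
  | Write p b => State I r (upd o (I p) b)
  end.

Definition eval (b : test) (st : state R) : bool :=
  match b with
  | ILe x y => (imem st x <= imem st y)%N
  | RLe x y => rmem st x <= rmem st y
  end.

(** [exec p st st' t]: started in [st], [p] halts in [st'] after time [t]. *)
Inductive exec : prog -> state R -> state R -> nat -> Prop :=
| exec_skip st : exec Skip st st 0
| exec_do c st : exec (Do c) st (step c st) 1
| exec_seq p q st1 st2 st3 t1 t2 :
    exec p st1 st2 t1 -> exec q st2 st3 t2 ->
    exec (Seq p q) st1 st3 (t1 + t2)
| exec_if b p q st st' t :
    exec (if eval b st then p else q) st st' t -> exec (If b p q) st st' t.+1
| exec_while_stop b p st :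
    ~~ eval b st -> exec (While b p) st st 1
| exec_while_loop b p st1 st2 st3 t1 t2 :
    eval b st1 -> exec p st1 st2 t1 -> exec (While b p) st2 st3 t2 ->
    exec (While b p) st1 st3 (t1 + t2).+1.

Definition init_state : state R :=
  State (fun x => nth 0%N [:: n; d] x) (fun=> 0) (fun=> false).

Definition output (st : state R) : bits n := [ffun j : 'I_n => omem st j].

Definition halts_with (p : prog) (s : bits n) (t : nat) : Prop :=
  exists2 st, exec p init_state st t & output st = s.

End Semantics.

(** A single program for all sizes computes [A] on [d >= 2n], in worst-case
    time O(f n d). *)
Definition runs_in_time_O (R : realType) (A : attack R) (f : nat -> nat -> R)
    : Prop :=
  exists (p : prog) (C : R), forall n d : nat, (0 < n)%N -> (2 * n <= d)%N ->
    forall (U : 'M[R]_(n, d)) (y : d.-tuple R),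
      exists2 t : nat, halts_with U y p (A n d U y) t & t%:R <= C * f n d.

(* Main.v *)
Require Import Defs.
From mathcomp Require Import all_boot all_order all_algebra.
From mathcomp Require Import all_classical all_reals all_analysis.
From mathcomp Require Import ring lra zify.

Set Implicit Arguments.
Unset Strict Implicit.
Unset Printing Implicit Defensive.

Import Order.TTheory GRing.Theory Num.Theory.
Import numFieldNormedType.Exports.

Local Open Scope ring_scope.

(** The attack may choose the scale of the public attributes. Let every column
    have entries [+- 4^-n 2^-k]. Both estimators solve the score equation
    [\sum_k u_k h(u_k theta) = \sum_k u_k s_k], where [h] (the identity or the
    logistic function) is 1-Lipschitz; hence a released value within 1 of
    [theta] determines the right-hand side up to [\sum_k u_k^2], which is
    smaller than half of the least [|u_k|]. As the [|u_k|] are superincreasing,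
    [s] is then decoded greedily, exactly, from a single column, and a majority
    vote over the columns absorbs a constant fraction of arbitrary answers.

    The logistic estimator does not exist when the signs of the column separate
    [s]. With one negative entry, at row [r], this happens only if [s] is the
    indicator of [r] or its complement; letting [r] be the column index modulo 4,
    at most [d / 4 + 1] columns are lost for any given [s]. *)

Definition logistic (R : realType) (x : R) : R := expR x / (1 + expR x).

Lemma logistic_gt0 (R : realType) (x : R) : 0 < logistic x.
Proof. by rewrite divr_gt0 ?addr_gt0 ?expR_gt0. Qed.

Lemma logisticN (R : realType) (x : R) : logistic (- x) = 1 - logistic x.
Proof.
rewrite /logistic expRN; have x0 := expR_gt0 x.
by field; rewrite !gt_eqF ?addr_gt0.
Qed.

Lemma logistic_ge_half (R : realType) (x : R) : 0 <= x -> 2^-1 <= logistic x.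
Proof.
move=> x0; have e1 : 1 <= expR x by rewrite -expR0 ler_expR.
by rewrite /logistic ler_pdivlMr; lra.
Qed.

Lemma logistic_lipschitz (R : realType) (x y : R) :
  `|logistic x - logistic y| <= `|x - y|.
Proof.
wlog yx : x y / y <= x.
  move=> H; case: (leP y x) => [/H //|/ltW /H].
  by rewrite distrC (distrC y).
have mono : logistic y <= logistic x.
  have ey := expR_gt0 y; have exy : expR y <= expR x by rewrite ler_expR.
  rewrite /logistic ler_pdivrMr ?addr_gt0 ?expR_gt0 //.
  by rewrite mulrAC ler_pdivlMr ?addr_gt0 ?expR_gt0 //; lra.
rewrite ger0_norm ?subr_ge0 // ger0_norm ?subr_ge0 //.
have := expR_ge1Dx (y - x); rewrite expRD expRN => bound.
apply: (@le_trans _ _ (1 - expR y / expR x)); last by lra.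
have ey := expR_gt0 y; have ex := expR_gt0 x.
rewrite /logistic -subr_ge0.
have -> : 1 - expR y / expR x - (expR x / (1 + expR x) - expR y / (1 + expR y))
  = ((1 + expR x) * (1 + expR y) - expR x) * (expR x - expR y)
    / (expR x * (1 + expR x) * (1 + expR y)).
  by field; rewrite !gt_eqF ?addr_gt0.
have : expR y <= expR x by rewrite ler_expR.
move=> exy; apply: divr_ge0; last by rewrite !mulr_ge0 ?addr_ge0 ?ltW.
by apply: mulr_ge0; nra.
Qed.

(* The weights [1 - p] and [p] cancel the linear terms in [1 + t <= expR t]. *)
Lemma expR_lt_chord (R : realType) (p x : R) : 0 < p < 1 -> x != 0 ->
  expR (p * x) < 1 - p + p * expR x.
Proof.
move=> /andP[p0 p1] x0.
have h1 : 1 + (- (p * x)) < expR (- (p * x)).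
  by rewrite expR_gt1Dx // oppr_eq0 mulf_neq0 // gt_eqF.
have h2 := expR_ge1Dx ((1 - p) * x).
have -> : x = p * x + (1 - p) * x by ring.
rewrite expRD; have e0 := expR_gt0 (p * x).
rewrite {1}(_ : p * (p * x + (1 - p) * x) = p * x); last by ring.
have h3 : expR (p * x) * expR (- (p * x)) = 1 by rewrite expRN divff ?gt_eqF.
rewrite -subr_gt0.
have -> : 1 - p + p * (expR (p * x) * expR ((1 - p) * x)) - expR (p * x)
  = expR (p * x) * ((1 - p) * (expR (- (p * x)) - (1 - p * x))
      + p * (expR ((1 - p) * x) - (1 + (1 - p) * x))).
  transitivity ((1 - p) * (expR (p * x) * expR (- (p * x)))
    + p * (expR (p * x) * expR ((1 - p) * x)) - expR (p * x)); last by ring.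
  by rewrite h3 mulr1.
by rewrite pmulr_rgt0 //; apply: ltr_wpDr; nra.
Qed.

Lemma ln1pexp_tangent_lt (R : realType) (a b : R) : a != b ->
  ln (1 + expR a) + logistic a * (b - a) < ln (1 + expR b).
Proof.
move=> ab; have ea := expR_gt0 a; have eb := expR_gt0 b.
rewrite -ltr_expR expRD !lnK ?posrE ?addr_gt0 //.
have p1 : 0 < logistic a < 1.
  by rewrite logistic_gt0 /logistic ltr_pdivrMr ?addr_gt0 //; lra.
have := expR_lt_chord p1 (x := b - a); rewrite subr_eq0 eq_sym ab => /(_ isT).
rewrite -(ltr_pM2l (x := 1 + expR a)) ?addr_gt0 // => /lt_le_trans; apply.
rewrite expRD expRN /logistic le_eqVlt; apply/orP; left; apply/eqP.
by field; rewrite !gt_eqF ?addr_gt0.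
Qed.

Definition mean_response (R : realType) (m : regression) (x : R) : R :=
  match m with Linear => x | Logistic => logistic x end.

Lemma mean_response_lipschitz (R : realType) m (x y : R) :
  `|mean_response m x - mean_response m y| <= `|x - y|.
Proof. by case: m => //=; exact: logistic_lipschitz. Qed.

(** * Existence of the estimators *)

Definition fitted (R : realType) m n (u : 'cV[R]_n) (theta : R) : R :=
  \sum_(j < n) u j ord0 * mean_response m (u j ord0 * theta).

Definition moment (R : realType) n (u : 'cV[R]_n) (s : bits n) : R :=
  \sum_(j < n) u j ord0 * (s j)%:R.

Lemma fitted_lipschitz (R : realType) m n (u : 'cV[R]_n) (x y : R) :
  `|fitted m u x - fitted m u y| <= (\sum_(j < n) u j ord0 ^+ 2) * `|x - y|.
Proof.
rewrite /fitted -sumrB (le_trans (ler_norm_sum _ _ _)) // mulr_suml.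
apply: ler_sum => j _; rewrite -mulrBr normrM.
apply: (@le_trans _ _ (`|u j ord0| * `|u j ord0 * x - u j ord0 * y|)).
  by rewrite ler_wpM2l // mean_response_lipschitz.
by rewrite -mulrBr normrM mulrA -normrM ger0_norm ?sqr_ge0.
Qed.

Lemma score_root_is_estimator (R : realType) m n (u : 'cV[R]_n) (s : bits n)
    (theta : R) (j0 : 'I_n) :
  u j0 ord0 != 0 -> fitted m u theta = moment u s -> is_estimator m u s theta.
Proof.
move=> u0; rewrite /fitted /moment; case: m => /= root theta' ne.
- rewrite /squared_error -subr_gt0 -sumrB.
  have -> : \sum_(j < n) (((s j)%:R - u j ord0 * theta') ^+ 2
             - ((s j)%:R - u j ord0 * theta) ^+ 2)
    = \sum_(j < n) (u j ord0 * (theta' - theta)) ^+ 2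
      + 2 * (theta' - theta) *
        (\sum_(j < n) u j ord0 * (u j ord0 * theta)
         - \sum_(j < n) u j ord0 * (s j)%:R).
    rewrite -sumrB mulr_sumr -big_split /=; apply: eq_bigr => j _; ring.
  rewrite root subrr mulr0 addr0 (bigD1 j0) //= ltr_wpDr //.
    by apply: sumr_ge0 => j _; exact: sqr_ge0.
  by rewrite lt_def sqr_ge0 sqrf_eq0 mulf_neq0 // subr_eq0.
- rewrite /log_likelihood -subr_gt0 -sumrB.
  pose gap j := ln (1 + expR (u j ord0 * theta'))
    - (ln (1 + expR (u j ord0 * theta))
       + logistic (u j ord0 * theta) * (u j ord0 * theta' - u j ord0 * theta)).
  have -> : \sum_(j < n) ((s j)%:R * u j ord0 * theta
                - ln (1 + expR (u j ord0 * theta))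
              - ((s j)%:R * u j ord0 * theta'
                - ln (1 + expR (u j ord0 * theta'))))
    = \sum_(j < n) gap j + (theta' - theta) *
        (\sum_(j < n) u j ord0 * logistic (u j ord0 * theta)
         - \sum_(j < n) u j ord0 * (s j)%:R).
    rewrite -sumrB mulr_sumr -big_split /=.
    by apply: eq_bigr => j _; rewrite /gap; ring.
  rewrite root subrr mulr0 addr0 (bigD1 j0) //= ltr_wpDr //.
    apply: sumr_ge0 => j _; rewrite subr_ge0.
    have [->|/ln1pexp_tangent_lt/ltW //] :=
      eqVneq (u j ord0 * theta) (u j ord0 * theta').
    by rewrite subrr mulr0 addr0.
  rewrite subr_gt0 ln1pexp_tangent_lt // -subr_eq0 -mulrBr mulf_neq0 //.
  by rewrite subr_eq0 eq_sym.
Qed.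

Definition aligned (R : realType) n (u : 'cV[R]_n) (s : bits n) (j : 'I_n) :=
  s j == (0 < u j ord0).

Lemma fitted_ge_moment (R : realType) n (u : 'cV[R]_n) (s : bits n) (j0 : 'I_n) :
  (forall j, u j ord0 != 0) -> ~~ aligned u s j0 ->
  moment u s <= fitted Logistic u (2 * n%:R / `|u j0 ord0|).
Proof.
move=> u0 j0P; set theta := 2 * n%:R / `|u j0 ord0|.
have w0 : 0 < `|u j0 ord0| by rewrite normr_gt0.
have n0 : (0 < n)%N by case: (n) j0 {j0P theta w0} => [[]|].
have t0 : 0 < theta by rewrite divr_gt0 ?mulr_gt0 ?ltr0n.
rewrite -subr_ge0 /fitted /moment -sumrB.
pose term j := u j ord0 * logistic (u j ord0 * theta) - u j ord0 * (s j)%:R.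
have termE j : term j = if aligned u s j
    then - (`|u j ord0| * logistic (- (`|u j ord0| * theta)))
    else `|u j ord0| * logistic (`|u j ord0| * theta).
  rewrite /term /aligned; case: (ltgtP 0 (u j ord0)) (u0 j) => [pos|neg|//] _.
  - rewrite ger0_norm ?ltW // logisticN; case: (s j) => /=; ring.
  - rewrite ltr0_norm // !mulNr !opprK logisticN; case: (s j) => /=; ring.
have small x : 0 < x -> x * logistic (- (x * theta)) <= theta^-1.
  move=> x0; have e0 := expR_gt0 (x * theta).
  have -> : logistic (- (x * theta)) = (1 + expR (x * theta))^-1.
    by rewrite /logistic expRN; field; rewrite !gt_eqF ?addr_gt0.
  rewrite ler_pdivrMr ?addr_gt0 // mulrC ler_pdivlMr //.
  by have := expR_ge1Dx (x * theta); lra.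
rewrite (bigD1 j0) //= -/(term j0).
have h0 : `|u j0 ord0| / 2 <= term j0.
  rewrite termE (negbTE j0P) ler_pM2l // logistic_ge_half //.
  by rewrite mulr_ge0 // ltW.
have h1 : - (n%:R * theta^-1) <= \sum_(j | j != j0) term j.
  have : \sum_(j < n | j != j0) - theta^-1 <= \sum_(j < n | j != j0) term j.
    apply: ler_sum => j _; rewrite termE; case: ifP => _.
      by rewrite lerN2 small // normr_gt0.
    apply: (@le_trans _ _ 0); first by rewrite oppr_le0 invr_ge0 ltW.
    by rewrite mulr_ge0 // ltW // logistic_gt0.
  apply: le_trans; rewrite sumr_const mulNrn lerN2 -[leLHS]mulr_natl.
  apply: ler_wpM2r; first by rewrite invr_ge0 ltW.
  by rewrite ler_nat -[X in (_ <= X)%N](card_ord n) max_card.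
have : n%:R * theta^-1 = `|u j0 ord0| / 2.
  rewrite /theta; field.
  by rewrite normr_eq0 u0 pnatr_eq0 -lt0n n0.
rewrite [\sum_(i | _) _](_ : _ = \sum_(j | j != j0) term j); last exact: eq_bigr.
move: h0 h1; lra.
Qed.

Lemma moment_compl (R : realType) n (u : 'cV[R]_n) (s : bits n) :
  moment u [ffun j => ~~ s j] = \sum_(j < n) u j ord0 - moment u s.
Proof.
rewrite /moment -sumrB; apply: eq_bigr => j _; rewrite ffunE.
case: (s j) => /=; ring.
Qed.

Lemma fitted_logisticN (R : realType) n (u : 'cV[R]_n) (theta : R) :
  fitted Logistic u (- theta) = \sum_(j < n) u j ord0 - fitted Logistic u theta.
Proof.
rewrite /fitted -sumrB; apply: eq_bigr => j _.
rewrite mulrN /= logisticN; ring.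
Qed.

Lemma continuous_fitted (R : realType) m n (u : 'cV[R]_n) :
  continuous (fitted m u).
Proof.
move=> x; apply/cvgrPdist_le => e e0.
pose K := 1 + \sum_(j < n) u j ord0 ^+ 2.
have K0 : 0 < K by rewrite ltr_wpDr // sumr_ge0 // => j _; exact: sqr_ge0.
have ke : 0 < e / K by rewrite divr_gt0.
near=> y; apply: le_trans (fitted_lipschitz _ _ _ _) _.
apply: (@le_trans _ _ (K * `|x - y|)); first by rewrite ler_wpM2r // /K lerDr.
rewrite mulrC -ler_pdivlMr; last exact: K0.
by near: y; apply: (@cvgr_dist_le _ _ _ _ _ id x).
Unshelve. all: by end_near. Qed.

Lemma logistic_score_root (R : realType) n (u : 'cV[R]_n) (s : bits n)
    (j0 j1 : 'I_n) :
  (forall j, u j ord0 != 0) -> ~~ aligned u s j0 -> aligned u s j1 ->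
  exists theta, fitted Logistic u theta = moment u s.
Proof.
move=> u0 j0P j1P.
have hi := fitted_ge_moment u0 j0P.
have lo : ~~ aligned u [ffun j => ~~ s j] j1.
  by move: j1P; rewrite /aligned ffunE => /eqP ->; case: (0 < _).
have {}lo := fitted_ge_moment u0 lo.
set b := 2 * n%:R / `|u j0 ord0| in hi.
set a := 2 * n%:R / `|u j1 ord0| in lo.
have a0 : 0 <= a by rewrite divr_ge0 ?mulr_ge0.
have b0 : 0 <= b by rewrite divr_ge0 ?mulr_ge0.
have {}lo : fitted Logistic u (- a) <= moment u s.
  by move: lo; rewrite moment_compl fitted_logisticN; lra.
have ab : - a <= b by lra.
have [|theta _ <-] := @IVT _ (fitted Logistic u) _ _ (moment u s) ab
  (continuous_subspaceT (@continuous_fitted R Logistic n u)); last by exists theta.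
by rewrite ge_min le_max lo hi orbT.
Qed.

Lemma linear_score_root (R : realType) n (u : 'cV[R]_n) (s : bits n) (j0 : 'I_n) :
  u j0 ord0 != 0 -> exists theta, fitted Linear u theta = moment u s.
Proof.
move=> u0; exists (moment u s / \sum_(j < n) u j ord0 ^+ 2).
rewrite /fitted /=; under eq_bigr do rewrite mulrA -expr2.
rewrite -mulr_suml mulrC divfK // gt_eqF // (bigD1 j0) //= ltr_wpDr //.
  by apply: sumr_ge0 => j _; exact: sqr_ge0.
by rewrite lt_def sqr_ge0 sqrf_eq0 u0.
Qed.

(** * Decoding a superincreasing column *)

Definition sign_of (R : realType) (b : bool) : R := if b then 1 else -1.

Fixpoint residual (R : realType) (u : nat -> R) (z : R) (j : nat) : R :=
  if j is k.+1 then
    let r := residual u z k in if 0 <= r * u k then r - u k else r + u k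
  else z.

Lemma residual_decodes (R : realType) (u : nat -> R) (s : nat -> bool) n (z e : R) :
  (forall j, (j < n)%N -> \sum_(j.+1 <= k < n) `|u k| + e < `|u j|) ->
  `|z - \sum_(0 <= k < n) sign_of R (s k) * u k| <= e ->
  forall j, (j < n)%N -> (0 <= residual u z j * u j) = s j.
Proof.
move=> super close.
have key j : (j < n)%N ->
    residual u z j = z - \sum_(0 <= k < j) sign_of R (s k) * u k ->
    (0 <= residual u z j * u j) = s j.
  move=> jn ->; move: close (super j jn).
  rewrite (big_cat_nat (n := j)) ?(ltnW jn) //= (big_ltn jn).
  set A := \sum_(0 <= k < j) _; set B := \sum_(j.+1 <= k < n) _ * _.
  have : `|B| <= \sum_(j.+1 <= k < n) `|u k|.
    rewrite (le_trans (ler_norm_sum _ _ _)) //; apply: ler_sum => k _.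
    by rewrite /sign_of; case: (s k); rewrite ?mul1r ?mulN1r ?normrN.
  move: (\sum_(_ <= _ < _) _) => S BS close super'.
  have : `|z - A - sign_of R (s j) * u j| < `|u j|.
    apply: le_lt_trans super'; apply: le_trans (lerD BS close).
    apply: le_trans (ler_normD _ _); rewrite le_eqVlt; apply/orP; left.
    by apply/eqP; congr (`|_|); ring.
  rewrite /sign_of; case: (s j); rewrite ?mul1r ?mulN1r ltr_norml.
    case: (ger0P (u j)) => uj /andP[h1 h2]; apply/idP; nra.
  case: (ger0P (u j)) => uj /andP[h1 h2]; apply/negbTE; rewrite -ltNge; nra.
move=> j jn; apply: (key) => //; elim: j jn => [|j IH] jn.
  by rewrite big_geq ?subr0.
have {}IH := IH (ltnW jn).
rewrite /= (key _ (ltnW jn) IH) big_nat_recr //= {}IH /sign_of.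
by case: (s j); ring.
Qed.

Lemma majority_sign (R : realType) d (b : 'I_d -> bool) (G : {set 'I_d}) (v : bool) :
  (forall i, i \in G -> b i = v) -> (d < 2 * #|G|)%N ->
  (0 <= \sum_(i < d) sign_of R (b i)) = v.
Proof.
move=> bG dG; have GC : (#|G| + #|~: G|)%N = d by rewrite cardsC card_ord.
have {}dG : #|~: G|%:R < #|G|%:R :> R by rewrite ltr_nat; lia.
rewrite (bigID (mem G)) /=.
have -> : \sum_(i in G) sign_of R (b i) = sign_of R v * #|G|%:R.
  rewrite -sumr_const mulr_sumr; apply: eq_bigr => i iG.
  by rewrite bG // mulr1.
have : `|\sum_(i | i \notin G) sign_of R (b i)| <= #|~: G|%:R.
  rewrite (le_trans (ler_norm_sum _ _ _)) // -sumr_const big_mkcond /=.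
  rewrite [leRHS]big_mkcond; apply: ler_sum => i _; rewrite inE.
  by case: ifP => // _; rewrite /sign_of; case: ifP; rewrite ?normrN normr1.
rewrite ler_norml => /andP[h1 h2]; rewrite /sign_of; case: v {bG}.
  by apply/idP; lra.
by apply/negbTE; rewrite -ltNge; lra.
Qed.

(** * The attack *)

Lemma read_attrE (R : realType) n d (U : 'M[R]_(n, d)) (j : 'I_n) (i : 'I_d) :
  read_attr U j i = U j i.
Proof. by rewrite /read_attr !valK. Qed.

Lemma read_respE (R : realType) d (y : d.-tuple R) (i : 'I_d) :
  read_resp y i = tnth y i.
Proof. by rewrite /read_resp valK. Qed.

(* [2 (fitted m u y_i) - \sum_k u_k] for the i-th column [u], an approximation
   of [\sum_k (2 s_k - 1) u_k]. *)
Definition centered_fit (R : realType) m n d (U : 'M[R]_(n, d)) (y : d.-tuple R)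
    (i : nat) : R :=
  \sum_(0 <= k < n)
    (mean_response m (read_attr U k i * read_resp y i)
     + mean_response m (read_attr U k i * read_resp y i) - 1) * read_attr U k i.

Definition column_bit (R : realType) m n d (U : 'M[R]_(n, d)) (y : d.-tuple R)
    (i j : nat) : bool :=
  0 <= residual (fun k => read_attr U k i) (centered_fit m U y i) j
       * read_attr U j i.

Definition vote (R : realType) m n d (U : 'M[R]_(n, d)) (y : d.-tuple R)
    (j : nat) : R :=
  \sum_(0 <= i < d) sign_of R (column_bit m U y i j).

Definition vote_attack (R : realType) (m : regression) : attack R :=
  fun n d U y => [ffun j : 'I_n => 0 <= vote m U y j].

(* Flipping one sign per column, at a position depending on [i %% 4], makes the
   separated databases differ between column types. *)
Definition public_attrs (R : realType) (n d : nat) : 'M[R]_(n, d) :=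
  \matrix_(j < n, i < d)
    (sign_of R (j != i %% 4 :> nat)%N * (2 ^+ n)^-1 ^+ 2 * (2 ^+ j)^-1).

Lemma sum_half_pow (R : realType) j n : (j < n)%N ->
  \sum_(j.+1 <= k < n) (2 ^+ k)^-1 = (2 ^+ j)^-1 - 2 * (2 ^+ n)^-1 :> R.
Proof.
elim: n => // n IH; rewrite ltnS leq_eqVlt => /predU1P[->|jn].
  by rewrite big_geq // exprS; field; rewrite expf_neq0 // pnatr_eq0.
rewrite big_nat_recr //= IH // exprS; field.
by rewrite !expf_neq0 // pnatr_eq0.
Qed.

Lemma sum_quarter_pow_le (R : realType) n :
  \sum_(0 <= k < n) (2 ^+ k)^-1 ^+ 2 <= 2 - 2 * (2 ^+ n)^-1 :> R.
Proof.
elim: n => [|n IH]; first by rewrite big_geq // expr0 invr1; lra.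
rewrite big_nat_recr //= (exprS 2 n) invfM.
have a0 : 0 < (2 ^+ n)^-1 :> R by rewrite invr_gt0 exprn_gt0.
have a1 : (2 ^+ n)^-1 <= 1 :> R by rewrite invf_le1 ?exprn_gt0 // exprn_ege1 // ler1n.
nra.
Qed.

Section PublicColumn.
Variables (R : realType) (n d : nat).
Hypothesis n_ge : (5 <= n)%N.
Let U : 'M[R]_(n, d) := public_attrs R n d.

Lemma norm_public_attrs (k : nat) (i : 'I_d) : (k < n)%N ->
  `|read_attr U k i| = (2 ^+ n)^-1 ^+ 2 * (2 ^+ k)^-1.
Proof.
move=> kn; rewrite (read_attrE U (Ordinal kn)) mxE /= -mulrA normrM.
rewrite (_ : `|sign_of R _| = 1) ?mul1r.
  by rewrite ger0_norm // mulr_ge0 ?exprn_ge0 ?invr_ge0 ?exprn_ge0.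
by rewrite /sign_of; case: ifP; rewrite ?normrN normr1.
Qed.

Lemma public_attrs_neq0 i j : col i U j ord0 != 0.
Proof.
rewrite !mxE !mulf_neq0 ?expf_neq0 ?invr_eq0 ?expf_neq0 ?pnatr_eq0 //.
by rewrite /sign_of; case: ifP; rewrite ?oppr_eq0 oner_eq0.
Qed.

Lemma public_attrs_superincreasing (i : 'I_d) j : (j < n)%N ->
  \sum_(j.+1 <= k < n) `|read_attr U k i|
    + 2 * \sum_(0 <= k < n) read_attr U k i ^+ 2 < `|read_attr U j i|.
Proof.
move=> jn; set a : R := (2 ^+ n)^-1.
rewrite norm_public_attrs //.
have -> : \sum_(j.+1 <= k < n) `|read_attr U k i|
    = a ^+ 2 * ((2 ^+ j)^-1 - 2 * a).
  rewrite -sum_half_pow // mulr_sumr big_nat_cond [RHS]big_nat_cond.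
  apply: eq_bigr => k /andP[/andP[_ kn] _]; exact: norm_public_attrs.
have -> : \sum_(0 <= k < n) read_attr U k i ^+ 2
    = a ^+ 4 * \sum_(0 <= k < n) (2 ^+ k)^-1 ^+ 2.
  rewrite mulr_sumr big_nat_cond [RHS]big_nat_cond.
  apply: eq_bigr => k /andP[/andP[_ kn] _].
  by rewrite -real_normK ?num_real // norm_public_attrs // -/a; ring.
have := sum_quarter_pow_le R n; rewrite -/a.
have a0 : 0 < a by rewrite invr_gt0 exprn_gt0.
have a4 : a <= 4^-1.
  rewrite lef_pV2 ?posrE ?exprn_gt0 // (_ : 4 = 2 ^+ 2); last by ring.
  by rewrite ler_eXn2l ?ltr1n //; lia.
set S := \sum_(0 <= k < n) _; set b : R := (2 ^+ j)^-1 => S2.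
have a3 : 0 < a ^+ 3 by rewrite exprn_gt0.
have : a ^+ 4 * S <= a ^+ 4 * 2 by rewrite ler_pM2l ?exprn_gt0 //; lra.
have -> : a ^+ 4 = a * a ^+ 3 by rewrite -exprS.
have -> : a ^+ 2 * (b - 2 * a) = a ^+ 2 * b - 2 * a ^+ 3 by ring.
nra.
Qed.

Lemma column_bit_correct m (s : bits n) (y : d.-tuple R) (i : 'I_d) (theta : R)
    (j : 'I_n) :
  fitted m (col i U) theta = moment (col i U) s -> `|tnth y i - theta| <= 1 ->
  column_bit m U y i j = s j.
Proof.
move=> root close.
pose s' k := if insub k is Some k' then s k' else false.
have -> : s j = s' j by rewrite /s' valK.
apply: (residual_decodes (@public_attrs_superincreasing i)) (ltn_ord j).
have -> : centered_fit m U y i = 2 * fitted m (col i U) (tnth y i)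
    - \sum_(k < n) U k i.
  rewrite /centered_fit big_mkord /fitted mulr_sumr -sumrB.
  by apply: eq_bigr => k _; rewrite read_attrE read_respE [col i U k ord0]mxE; ring.
have -> : \sum_(0 <= k < n) sign_of R (s' k) * read_attr U k i
    = 2 * moment (col i U) s - \sum_(k < n) U k i.
  rewrite big_mkord /moment mulr_sumr -sumrB; apply: eq_bigr => k _.
  by rewrite read_attrE [col i U k ord0]mxE /s' valK /sign_of; case: (s k) => /=; ring.
rewrite -root (_ : forall a b c : R, 2 * a - c - (2 * b - c) = 2 * (a - b));
  last by move=> *; ring.
rewrite normrM (ger0_norm (ler0n _ 2)) ler_pM2l //.
apply: le_trans (fitted_lipschitz _ _ _ _) _.
rewrite big_mkord (eq_bigr (fun k : 'I_n => read_attr U k i ^+ 2)); last first.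
  by move=> k _; rewrite [col i U k ord0]mxE read_attrE.
by rewrite ler_piMr // sumr_ge0 // => k _; exact: sqr_ge0.
Qed.

Definition separated (s : bits n) (r : nat) : bool :=
  [forall k : 'I_n, s k == (k != r :> nat)] ||
  [forall k : 'I_n, s k == (k == r :> nat)].

Lemma estimator_exists m (s : bits n) (i : 'I_d) : ~~ separated s (i %% 4) ->
  exists theta, fitted m (col i U) theta = moment (col i U) s
    /\ is_estimator m (col i U) s theta.
Proof.
rewrite negb_or !negb_forall => /andP[/existsP[j0 h0] /existsP[j1 h1]].
have alignedE j : aligned (col i U) s j = (s j == (j != i %% 4 :> nat)%N).
  rewrite /aligned !mxE -mulrA pmulr_lgt0.
    by rewrite /sign_of; case: ifP; rewrite ?ltr01 // oppr_gt0 ltr10.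
  by rewrite mulr_gt0 ?exprn_gt0 ?invr_gt0 ?exprn_gt0.
have n0 := @public_attrs_neq0 i.
have [theta root] : exists theta, fitted m (col i U) theta = moment (col i U) s.
  case: m; first exact: (linear_score_root _ (n0 j0)).
  apply: (logistic_score_root (j0 := j0) (j1 := j1)) => //; rewrite alignedE //.
  by move: h1; case: (s j1); case: (_ == _ :> nat).
by exists theta; split => //; exact: (score_root_is_estimator (n0 j0)).
Qed.

Lemma separated_inj (s : bits n) (r r' : nat) : (r < 4)%N -> (r' < 4)%N ->
  separated s r -> separated s r' -> r = r'.
Proof.
move=> r4 r'4 sr sr'; apply/eqP; apply: contraT => ne.
have [t [t5 tr tr']] : exists t, [/\ (t < 5)%N, t != r & t != r'].
  by exists 4; split => //; lia.
have rn : (r < n)%N by lia.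
have r'n : (r' < n)%N by lia.
have tn : (t < n)%N by lia.
move: sr sr'; rewrite /separated.
by case/orP => /forallP h; case/orP => /forallP h';
  move: (h (Ordinal rn)) (h' (Ordinal rn)) (h (Ordinal tn)) (h' (Ordinal tn));
  rewrite /= eqxx ?(negbTE ne) ?(negbTE tr) ?(negbTE tr') /=
    => /eqP -> // => _ /eqP ->.
Qed.

Lemma card_separated (s : bits n) :
  (#|[set i : 'I_d | separated s (i %% 4)]%SET| <= (d %/ 4).+1)%N.
Proof.
rewrite -[leqRHS]card_ord.
apply: (@leq_card_in _ _ (fun i : 'I_d => inord (i %/ 4) : 'I_(d %/ 4).+1)).
move=> i i'; rewrite !inE => si si' /(congr1 val).
rewrite /= !inordK ?ltnS ?leq_div2r 1?ltnW // => e.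
apply: val_inj; rewrite /= (divn_eq i 4) (divn_eq i' 4) e.
by rewrite (separated_inj _ _ si si') // ltn_pmod.
Qed.

Lemma vote_attack_exact m (s : bits n) (y : d.-tuple R) (delta : R) :
  (2 * n <= d)%N -> delta <= 1 ->
  (1 - 8^-1) * d%:R <=
    #|[set i | `[< accurate_at m U s delta y i >]]%SET|%:R :> R ->
  vote_attack m U y = s.
Proof.
move=> nd delta1; set Acc := [set i | _]%SET => cardAcc.
pose B := [set i : 'I_d | separated s (i %% 4)]%SET.
apply/ffunP => j; rewrite ffunE /vote big_mkord.
apply: (@majority_sign _ _ _ (Acc :\: B)%SET) => [i|].
  rewrite !inE => /andP[sep /asboolP acc].
  have [theta [root est]] := estimator_exists m sep.
  by apply: (column_bit_correct _ root); apply: le_trans (acc _ est) delta1.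
have cB : (#|B| <= (d %/ 4).+1)%N := card_separated s.
have cD : (#|Acc| <= #|Acc :\: B| + #|B|)%N.
  by rewrite -(cardsID B Acc) addnC leq_add2l subset_leq_card // subsetIr.
have : (7 * d <= 8 * #|Acc|)%N by rewrite -(ler_nat R) !natrM; lra.
by move: (#|Acc|) (#|B|) (#|Acc :\: B|) cB cD => a b c; lia.
Qed.

End PublicColumn.

Lemma ae_reconstruction (R : realType) n d (M : mechanism R n d)
    (A : 'M[R]_(n, d) -> d.-tuple R -> bits n) (U : 'M[R]_(n, d)) :
  (forall s, {ae M U s, forall y, A U y = s}) ->
  allows_reconstruction_by M A 0 0.
Proof.
move=> AU; exists U => s; have [B [mB B0 AB]] := AU s.
exists (~` B)%classic; split; first exact: measurableC.
  move=> y /= By; have -> : A U y = s by apply: contrapT => h; exact/By/AB.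
  by rewrite /hamming eq_card0 // => j; rewrite !inE eqxx.
by rewrite probability_setC // B0 sube0 subr0.
Qed.

Lemma vote_attack_non_private (R : realType) m (d : nat -> nat)
    (M : mechanism_family R d) :
  (forall n, (2 * n <= d n)%N) ->
  releases_most_estimators m 8^-1 M ->
  attribute_non_private_by (@vote_attack R m) M.
Proof.
move=> nd [delta small acc].
have [N _ delta1] : \forall n \near \oo%classic, delta n * Num.sqrt n%:R < 1.
  exact: (cvgr_lt 0 small).
exists (fun k => k + N + 5)%N, (fun=> 0), (fun=> 0); split.
- by move=> k l kl; rewrite !ltn_add2r.
- by under eq_cvg do rewrite mul0r; exact: cvg_cst.
- exact: cvg_cst.
move=> k; set n := (k + N + 5)%N.
have n5 : (5 <= n)%N by rewrite /n; lia.
apply: (ae_reconstruction (U := public_attrs R n (d n))) => s.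
have dn1 : delta n <= 1.
  have h : delta n * Num.sqrt n%:R < 1 by apply: delta1; rewrite /= /n; lia.
  have sq : 1 <= Num.sqrt n%:R :> R by rewrite -[leLHS]sqrtr1 ler_wsqrtr // ler1n; lia.
  by rewrite leNgt; apply/negP => d1; nra.
apply: negligibleS (acc n (public_attrs R n (d n)) s) => y /= neq most.
by apply: neq; exact: (vote_attack_exact n5 (nd n) dn1 most).
Qed.

(** * The attack as a real RAM program *)

Fixpoint seqs (cs : seq instr) (p : prog) : prog :=
  if cs is c :: cs' then Seq (Do c) (seqs cs' p) else p.

(* Runs [body] with I[x] = 0, ..., I[b] - 1. I[c] is one ahead of I[x], since
   the only integer test is the weak inequality; I[2] holds the constant 1. *)
Definition for_loop (x c b : nat) (body : prog) : prog :=
  Seq (Do (IConst c 1))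
    (While (ILe c b) (Seq (Seq (Do (ISub x c 2)) body) (Do (IAdd c c 2)))).

Definition response_code (m : regression) : seq instr :=
  match m with
  | Linear => [::]
  | Logistic => [:: RExp 6 6; RAdd 7 6 1; RDiv 6 6 7]
  end.

Definition centered_fit_code (m : regression) : prog :=
  for_loop 7 8 0
    (seqs ([:: ReadAttr 4 7 5; RMul 6 4 5] ++ response_code m ++
           [:: RAdd 6 6 6; RSub 6 6 1; RMul 6 6 4; RAdd 3 3 6]) Skip).

Definition residual_code : prog :=
  for_loop 7 8 3
    (seqs [:: ReadAttr 4 7 5; RMul 6 3 4]
      (If (RLe 0 6) (Do (RSub 3 3 4)) (Do (RAdd 3 3 4)))).

Definition column_code (m : regression) : prog :=
  seqs [:: ReadResp 5 5; RConst 3 0]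
    (Seq (centered_fit_code m) (Seq residual_code
      (seqs [:: ReadAttr 4 3 5; RMul 6 3 4]
        (If (RLe 0 6) (Do (RAdd 2 2 1)) (Do (RSub 2 2 1)))))).

Definition attack_code (m : regression) : prog :=
  seqs [:: IConst 2 1; RConst 1 1]
    (for_loop 3 4 0
      (seqs [:: RConst 2 0]
        (Seq (for_loop 5 6 1 (column_code m))
          (If (RLe 0 2) (Do (Write 3 true)) (Do (Write 3 false)))))).

Section Execution.
Variables (R : realType) (n d : nat) (U : 'M[R]_(n, d)) (y : d.-tuple R).

Definition reaches (p : prog) (st : state R) (T : nat) (Q : state R -> Prop) :=
  exists st' t, [/\ exec U y p st st' t, Q st' & (t <= T)%N].

Lemma reaches_skip st T (Q : state R -> Prop) : Q st -> reaches Skip st T Q.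
Proof. by move=> q; exists st, 0%N; split => //; exact: exec_skip. Qed.

Lemma reaches_do c st T (Q : state R -> Prop) :
  Q (step U y c st) -> reaches (Do c) st T.+1 Q.
Proof. by move=> q; exists (step U y c st), 1%N; split => //; exact: exec_do. Qed.

Lemma reaches_seq p q st T1 T2 (Q1 Q : state R -> Prop) :
  reaches p st T1 Q1 -> (forall st', Q1 st' -> reaches q st' T2 Q) ->
  reaches (Seq p q) st (T1 + T2) Q.
Proof.
move=> [st1 [t1 [e1 q1 l1]]] /(_ _ q1)[st2 [t2 [e2 q2 l2]]].
by exists st2, (t1 + t2)%N; split; [exact: exec_seq e1 e2| |exact: leq_add].
Qed.

Lemma reaches_seqs cs p st T (Q : state R -> Prop) :
  reaches p (foldl (fun st c => step U y c st) st cs) T Q ->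
  reaches (seqs cs p) st (size cs + T) Q.
Proof.
elim: cs st => [//|c cs IH] st /= h; rewrite addSn -add1n.
apply: (reaches_seq (Q1 := fun st' => st' = step U y c st)).
  exact: reaches_do.
by move=> _ ->; exact: IH.
Qed.

Lemma reaches_if b p q st T (Q : state R -> Prop) :
  (if Defs.eval b st then reaches p st T Q else reaches q st T Q) ->
  reaches (If b p q) st T.+1 Q.
Proof.
move=> h; have [st' [t [e q' l]]] : reaches (if Defs.eval b st then p else q) st T Q.
  by case: Defs.eval h.
by exists st', t.+1; split => //; exact: exec_if.
Qed.

Lemma reaches_sub p st T (Q Q' : state R -> Prop) :
  (forall st', Q st' -> Q' st') -> reaches p st T Q -> reaches p st T Q'.
Proof. by move=> sub [st' [t [e q l]]]; exists st', t; split => //; exact: sub. Qed.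

Lemma reaches_time p st T T' (Q : state R -> Prop) :
  (T <= T')%N -> reaches p st T Q -> reaches p st T' Q.
Proof.
by move=> TT [st' [t [e q l]]]; exists st', t; split => //; exact: leq_trans TT.
Qed.

Lemma reaches_for x c b body (Inv : nat -> state R -> Prop) st0 T N :
  (forall k st v, Inv k st -> Inv k (State (upd (imem st) c v) (rmem st) (omem st))) ->
  (forall k st, Inv k st -> imem st b = N /\ imem st 2 = 1%N) ->
  c != b -> c != 2 ->
  (forall k st, (k < N)%N -> Inv k st -> imem st c = k.+1 ->
     reaches body (State (upd (imem st) x k) (rmem st) (omem st)) T
       (fun st' => Inv k.+1 st' /\ imem st' c = k.+1)) ->
  Inv 0%N st0 ->
  reaches (for_loop x c b body) st0 ((T + 3) * N + 2) (Inv N).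
Proof.
move=> stable regs cb c2 bodyP inv0.
rewrite (addnC _ 2); apply: (reaches_time (T := 1 + ((T + 3) * N + 1))).
  by rewrite addnC -addnA addnC.
apply: (reaches_seq (Q1 := fun st => Inv 0%N st /\ imem st c = 1%N)).
  apply: reaches_do; split; last by rewrite /= /upd eqxx.
  exact: stable.
move=> st [inv cE].
suff loop k : (k <= N)%N -> forall st, Inv (N - k)%N st -> imem st c = (N - k).+1 ->
    reaches (While (ILe c b) (Seq (Seq (Do (ISub x c 2)) body) (Do (IAdd c c 2))))
      st ((T + 3) * k + 1) (Inv N).
  by apply: loop; rewrite ?subnn.
elim: k => [|k IH] kN {inv cE}st inv cE.
  exists st, 1%N; split; rewrite ?muln0 //; last by move: inv; rewrite subn0.
  apply: exec_while_stop; rewrite /= cE; have [-> _] := regs _ _ inv.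
  by rewrite subn0 ltnn.
have [bE oneE] := regs _ _ inv.
have lt : (N - k.+1 < N)%N by lia.
have kE : (N - k.+1).+1 = (N - k)%N by lia.
have [st1 [t1 [e1 [inv1 c1] l1]]] : reaches
    (Seq (Seq (Do (ISub x c 2)) body) (Do (IAdd c c 2))) st (1 + T + 1)
    (fun st' => Inv (N - k)%N st' /\ imem st' c = (N - k).+1).
  apply: (reaches_seq (Q1 := fun st' => Inv (N - k)%N st' /\ imem st' c = (N - k)%N)).
    apply: (reaches_seq (Q1 := fun st' => st' = step U y (ISub x c 2) st)).
      exact: reaches_do.
    by move=> _ ->; rewrite -kE /= cE oneE subn1; exact: bodyP.
  move=> st' [inv' cE']; apply: reaches_do; split; first exact: stable.
  by have [_ one] := regs _ _ inv'; rewrite /= /upd eqxx cE' one addn1.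
have [st2 [t2 [e2 q2 l2]]] := IH (ltnW kN) st1 inv1 c1.
exists st2, (t1 + t2).+1; split => //; last by lia.
by apply: exec_while_loop e1 e2; rewrite /= cE bE.
Qed.

Variable m : regression.

Definition globals (st : state R) :=
  [/\ imem st 0 = n, imem st 1 = d, imem st 2 = 1%N, rmem st 0 = 0 & rmem st 1 = 1].

Definition in_row (j : nat) (st : state R) :=
  [/\ globals st, imem st 3 = j, imem st 4 = j.+1 &
      forall l, (l < j)%N -> omem st l = (0 <= vote m U y l)].

Definition in_column (j i : nat) (v : R) (st : state R) :=
  [/\ in_row j st, imem st 5 = i, imem st 6 = i.+1, rmem st 5 = read_resp y i &
      rmem st 2 = v].

Lemma centered_fit_code_correct j i v st :
  in_column j i v st -> rmem st 3 = 0 ->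
  reaches (centered_fit_code m) st (12 * n + 2)
    (fun st' => in_column j i v st' /\ rmem st' 3 = centered_fit m U y i).
Proof.
move=> inv z0; pose term k := (mean_response m (read_attr U k i * read_resp y i)
  + mean_response m (read_attr U k i * read_resp y i) - 1) * read_attr U k i.
apply: (@reaches_for _ _ _ _ (fun k st' => in_column j i v st' /\
  rmem st' 3 = \sum_(0 <= l < k) term l) _ 9 n) => //.
- by move=> k st' [[[[]]]].
- move=> k {inv z0}st kn [[[[? ? ? z1 o1] ? ? ?] i5 i6 r5 ?] zE] cE.
  rewrite big_nat_recr // -zE.
  apply: (reaches_time (T := size ([:: ReadAttr 4 7 5; RMul 6 4 5] ++
     response_code m ++ [:: RAdd 6 6 6; RSub 6 6 1; RMul 6 6 4; RAdd 3 3 6]) + 0)).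
    by case: (m).
  apply: reaches_seqs; apply: reaches_skip.
  rewrite /term; case: (m) => /=; do !split; rewrite /= /upd /= ?i5 ?r5 ?o1 //.
  by rewrite /logistic (addrC 1).
- by rewrite big_geq.
Qed.

Lemma residual_code_correct j i v z st :
  in_column j i v st -> rmem st 3 = z ->
  reaches residual_code st (7 * j + 2)
    (fun st' => in_column j i v st' /\
       rmem st' 3 = residual (fun k => read_attr U k i) z j).
Proof.
move=> inv z0.
apply: (@reaches_for _ _ _ _ (fun k st' => in_column j i v st' /\
  rmem st' 3 = residual (fun k => read_attr U k i) z k) _ 4 j) => //.
- by move=> k st' [[[[]]]].
- move=> k {inv z0}st kn [[[[? ? ? z1 o1] ? ? ?] i5 i6 r5 ?] zE] cE.
  apply: (@reaches_seqs [:: _; _] _ _ 2); apply: reaches_if.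
  rewrite /= /upd /= i5 z1 zE.
  by case: ifP => pos; apply: reaches_do; do !split; rewrite /= /upd /= ?i5 ?zE ?pos.
Qed.

Lemma column_code_correct j i v st : (j < n)%N ->
  in_row j st -> imem st 5 = i -> imem st 6 = i.+1 -> rmem st 2 = v ->
  reaches (column_code m) st (19 * n + 10)
    (fun st' => [/\ in_row j st', imem st' 6 = i.+1 &
       rmem st' 2 = v + sign_of R (column_bit m U y i j)]).
Proof.
move=> jn [[? ? ? ? ?] ? ? ?] i5 ? ?.
apply: (reaches_time (T := 2 + (12 * n + 2 + (7 * j + 2 + 4)))); first by lia.
apply: reaches_seqs; apply: reaches_seq.
  apply: (centered_fit_code_correct (j := j) (i := i) (v := v)) => //.
  by do !split; rewrite //= /upd /= ?i5.
move=> st1 [inv zE]; apply: reaches_seq; first exact: residual_code_correct inv zE.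
move=> st2 [[[[? ? ? z0 o1] i3 ? ?] i5' ? ? vE] zE'].
apply: (@reaches_seqs [:: _; _] _ _ 2); apply: reaches_if.
rewrite /= /upd /= i5' i3 z0 zE' /column_bit.
by case: ifP => pos; apply: reaches_do; do !split;
  rewrite /= /upd /= ?vE ?o1 ?pos.
Qed.

Lemma attack_code_correct :
  reaches (attack_code m) (init_state R n d)
    (2 + ((1 + (((19 * n + 10) + 3) * d + 2 + 2) + 3) * n + 2))
    (fun st => output n st = vote_attack m U y).
Proof.
apply: reaches_seqs.
apply: (reaches_sub (Q := fun st => globals st /\
   forall l, (l < n)%N -> omem st l = (0 <= vote m U y l))).
  by move=> st [_ oE]; apply/ffunP => j; rewrite !ffunE oE.
apply: (@reaches_for _ _ _ _ (fun j st => globals st /\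
   forall l, (l < j)%N -> omem st l = (0 <= vote m U y l))) => //.
- by move=> k st [[]].
- move=> j st jn [[? ? ? ? ?] oE] i4.
  apply: (@reaches_seqs [:: RConst 2 0]); apply: reaches_seq.
    apply: (@reaches_for _ _ _ _ (fun i st => in_row j st /\
      rmem st 2 = \sum_(0 <= i' < i) sign_of R (column_bit m U y i' j))) => //.
    - by move=> k st' [[[]]].
    - move=> i st1 id [[[? ? ? ? ?] ? ? ?] vE] i6.
      apply: reaches_sub; last first.
        exact: (column_code_correct (i := i) (j := j) (v := rmem st1 2)).
      by move=> st' [? ? ->]; rewrite big_nat_recr //= vE.
    - by split; last rewrite big_geq.
  move=> st1 [[[? ? ? z0 ?] i3 i4' oE'] vE].
  apply: reaches_if; rewrite /= vE z0 -/(vote m U y j).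
  by case: ifP => pos; apply: reaches_do; split=> //; split=> // l;
    rewrite /= i3 /upd ltnS leq_eqVlt; case: eqP => [->|_ /oE'].
Qed.

End Execution.

Lemma vote_attack_runs_in_time (R : realType) (m : regression)
    (f : nat -> nat -> R) :
  (forall n d, (0 < n)%N -> (2 * n <= d)%N -> d%:R * n%:R ^+ 2 <= f n d) ->
  runs_in_time_O (@vote_attack R m) f.
Proof.
move=> fP; exists (attack_code m), 50%:R => n d n0 nd U y.
have [st [t [e o l]]] := attack_code_correct U y m.
exists t; first by exists st.
apply: (@le_trans _ _ (50%:R * (d%:R * n%:R ^+ 2))); last first.
  by rewrite ler_pM2l ?ltr0n // fP.
rewrite -natrX -!natrM ler_nat (leq_trans l) //.
have h1 : (n <= d * (n * n))%N by nia.
have h2 : (d * n <= d * (n * n))%N by nia.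
have h3 : (1 <= d * (n * n))%N by nia.
nia.
Qed.

Theorem theorem4p2 (R : realType) :
  (forall m : regression,
    exists A : attack R,
      runs_in_time_O A (fun n d => d%:R * n%:R ^+ 2) /\
      forall (d : nat -> nat) (M : mechanism_family R d),
        (forall n, (2 * n <= d n)%N) ->
        releases_all_estimators m M ->
        attribute_non_private_by A M)
  /\
  (exists gamma : R, 0 < gamma /\
    forall m : regression,
      exists A : attack R,
        runs_in_time_O A (fun n d => d%:R ^+ 2 * n%:R ^+ 3
                                     + d%:R `^ (5 / 2) * n%:R ^+ 2) /\
        forall (d : nat -> nat) (M : mechanism_family R d),
          (forall n, (2 * n <= d n)%N) ->
          releases_most_estimators m gamma M ->
          attribute_non_private_by A M).
Proof.
split=> [m|].
  exists (@vote_attack R m); split; first exact: vote_attack_runs_in_time.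
  move=> d M nd [delta small acc]; apply: vote_attack_non_private => //.
  exists delta => // n U s; apply: negligibleS (acc n U s) => y /= most all.
  apply: most; rewrite (_ : [set i | _]%SET = [set: 'I_(d n)]%SET).
    by rewrite cardsT card_ord ler_piMl //; lra.
  by apply/setP => i; rewrite !inE; apply/asboolP; exact: all.
exists 8^-1; split=> [|m]; first by rewrite invr_gt0.
exists (@vote_attack R m); split; last exact: vote_attack_non_private.
apply: vote_attack_runs_in_time => n d n0 nd.
apply: ler_wpDr; first by rewrite mulr_ge0 ?powR_ge0 ?exprn_ge0.
by rewrite -!natrX -!natrM ler_nat leq_mul // ?leq_pexp2l // expnS expn1 leq_pmulr //; lia.
Qed.
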